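(* Let $X \neq \{0\}$ be a real Banach space with the Daugavet property. Then there exists a set $B\subset X$ which is SCD such that $B \cup (-B)$ is not SCD.
   Context: All Banach spaces are real. For a non-empty bounded set $A \subset X$, a slice of $A$ is a (non-empty) set of the form $S(A,x^*,\varepsilon)=\{x\in A : x^*(x) > \sup_{a\in A} x^*(a)-\varepsilon\}$ with $x^*\in X^*\setminus\{0\}$ and $\varepsilon>0$. A sequence $(U_n)_{n\in\mathbb N}$ of non-empty subsets of a bounded set $A\subset X$ is called determining (for $A$) if for every $B\subset X$ with $B\cap U_n\neq\emptyset$ for all $n$ one has $A\subset\overline{\mathrm{conv}}(B)$ (norm-closed convex hull). A bounded set $A$ is SCD (slicely countably determined) if it has a determining sequence consisting of slices of $A$; SCD sets are by definition bounded. A Banach space $X$ has the Daugavet property if every bounded linear rank-one operator $T\colon X\to X$ satisfies $\|I+T\|=1+\|T\|$. *)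

(* Defs.v *)
From HB Require Import structures.
From mathcomp Require Import all_boot all_order all_algebra.
From mathcomp Require Import all_classical all_reals all_analysis.

Set Implicit Arguments.
Unset Strict Implicit.
Unset Printing Implicit Defensive.

Import Order.TTheory GRing.Theory Num.Theory.
Import numFieldNormedType.Exports.

Local Open Scope classical_set_scope.
Local Open Scope ring_scope.

(* The supremum is the usual operator norm only when [T] is a bounded linear
   operator; [sup] is 0 on sets without a supremum. *)
Definition opnorm (R : realType) (V W : normedModType R) (T : V -> W) : R :=
  sup [set `|T x| | x in [set x : V | `|x| <= 1]].

Definition rank_one (R : realType) (V W : normedModType R)
    (T : {linear V -> W}) : Prop :=
  exists2 y : W, y != 0 & range T = [set a *: y | a in [set: R]].

(* [bounded_near T (nbhs 0)] is boundedness of the linear operator [T]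
   (see [linear_boundedP]). *)
Definition Daugavet_property (R : realType) (X : normedModType R) : Prop :=
  forall T : {linear X -> X},
    bounded_near T (nbhs (0 : X)) -> rank_one T ->
    opnorm (fun x => x + T x) = 1 + opnorm T.

Definition slice (R : realType) (X : normedModType R) (A : set X)
    (f : X -> R) (e : R) : set X :=
  [set x | A x /\ sup [set f a | a in A] - e < f x].

Definition is_slice (R : realType) (X : normedModType R)
    (A S : set X) : Prop :=
  S !=set0 /\
  exists (f : {linear X -> R^o}) (e : R),
    [/\ continuous f, (f : X -> R) <> cst 0, 0 < e & S = slice A f e].

Definition conv_hull (R : realType) (X : normedModType R)
    (B : set X) : set X :=
  smallest (@convex_set R X) B.

Definition determining (R : realType) (X : normedModType R) (A : set X)
    (U : nat -> set X) : Prop :=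
  (forall n, U n !=set0 /\ U n `<=` A) /\
  forall B : set X, (forall n, B `&` U n !=set0) ->
    A `<=` closure (conv_hull B).

(* Boundedness makes the suprema in the slices of [A] genuine. *)
Definition SCD (R : realType) (X : normedModType R) (A : set X) : Prop :=
  bounded_set A /\
  exists U : nat -> set X, (forall n, is_slice A (U n)) /\ determining A U.

(* Main.v *)
From HB Require Import structures.
Require Import Defs.
From mathcomp Require Import all_boot all_order all_algebra.
From mathcomp Require Import all_classical all_reals all_analysis.
From mathcomp Require Import ring lra.

Set Implicit Arguments.
Unset Strict Implicit.
Unset Printing Implicit Defensive.

Import Order.TTheory GRing.Theory Num.Theory.
Import numFieldNormedType.Exports.

Local Open Scope classical_set_scope.
Local Open Scope ring_scope.

(** The set is [B], a countable bounded set all of whose points are, as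
    singletons, slices of [B]; such a set is trivially SCD. Its symmetrization
    loses this property because the points are placed so that they are exposed
    in [B] only, while the Daugavet property takes over in the union.

    Fix a unit vector [e]. The Daugavet property implies that every slice of
    the unit ball contains points that are almost l1-orthogonal to a given
    finite set ([daugavet_finite]), hence that every [z] in the open unit ball
    is a convex combination of finitely many points almost l1-orthogonal to a
    given totally bounded set ([children]). Iterating, one gets a tree with
    finite levels in which every node is a convex combination of nodes of the
    next level, and in which each node is almost l1-orthogonal to [e] and to
    the nodes of all lower levels ([levels]). With [s] rapidly decreasing
    along the levels, replace a node [y] of level [n] by [(1 - s n) y - s n
    a], where [a = 8 e], and add the point [a].

    A functional adapted to [y], close to one at [y], about one half at most
    on lower levels and negative at [a], defines a slice that consists of
    points of the level of [y] only ([select_functional], [exposed_point]). As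
    this slice is finite, it contains an exposed point
    ([finite_slice_exposed]). Let [B] be the set of exposed points; by
    perturbing the functional one sees that the exposed points of a level are
    almost as large as all points of that level for any given functional.

    In the union of [B] and [- B] also [- a] is present, and the perturbed
    node is the convex combination [(1 - s n) y + s n (- a)]. So a slice of
    the union that contains neither [a] nor [- a] is already charged by the
    node [y], hence by descendants of [y] at all deeper levels, and it
    contains points of arbitrarily deep levels ([slice_contains_deep]). Given
    any sequence of slices, choose in each of them [a], [- a] or a point of
    level higher than those chosen before and than that of some fixed point of
    [B]. Almost l1-orthogonality keeps that point away from the closed convex
    hull of the chosen ones ([far_from_deep]), so the sequence is not
    determining. *)

(** * Hahn-Banach with prescribed lower bounds *)
Section Sublinear.
Variables (R : realType) (X : lmodType R).
Implicit Types (p q : X -> R) (P : set (X -> R)) (T : X -> R -> Prop).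

(** Only one inequality is asked for homogeneity, so that it passes to infima;
    [sublinearZ] recovers the equality. *)
Definition sublinear p :=
  (forall x y, p (x + y) <= p x + p y) /\
  (forall (t : R) x, 0 <= t -> p (t *: x) <= t * p x).

Lemma sublinearZ p (t : R) x : sublinear p -> 0 <= t -> p (t *: x) = t * p x.
Proof.
move=> [pD pZ]; rewrite le_eqVlt => /predU1P[<-|t0].
  have := pD 0 0; have := pZ 0 0 (lexx _).
  by rewrite !scale0r addr0; lra.
apply/le_anti; rewrite (pZ _ _ (ltW t0))/= -ler_pdivlMl//.
have /(le_trans _) : p (t^-1 *: (t *: x)) <= t^-1 * p (t *: x).
  by apply: pZ; rewrite invr_ge0 ltW.
by apply; rewrite scalerA mulVf ?gt_eqF// scale1r.
Qed.

Lemma sublinear0 p : sublinear p -> p 0 = 0.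
Proof. by move=> /(@sublinearZ p 0 0) /(_ (lexx _)); rewrite scale0r mul0r. Qed.

Lemma sublinear_ge p x : sublinear p -> - p (- x) <= p x.
Proof. by move=> sp; have := sp.1 x (- x); rewrite subrr sublinear0//; lra. Qed.

Definition inf_fun P x : R := inf [set f x | f in P].

Lemma inf_fun_le P (m : X -> R) f x :
  (forall g y, P g -> m y <= g y) -> P f -> inf_fun P x <= f x.
Proof.
move=> mP Pf; apply: ge_inf; last by exists f.
by exists (m x) => _ [g Pg <-]; exact: mP.
Qed.

Lemma le_inf_fun P r x :
  P !=set0 -> (forall g, P g -> r <= g x) -> r <= inf_fun P x.
Proof.
move=> [f Pf] rP; apply: lb_le_inf; first by exists (f x), f.
by move=> _ [g Pg <-]; exact: rP.
Qed.

(** The two kinds of infima needed below, over constraints and over a chain,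
    are treated at once: it suffices that sums and multiples of values of
    members are bounded below by values of members. *)
Lemma sublinear_inf P (m : X -> R) : P !=set0 ->
  (forall f x, P f -> m x <= f x) ->
  (forall f g x y, P f -> P g -> exists2 h, P h & h (x + y) <= f x + g y) ->
  (forall f (t : R) x, P f -> 0 <= t ->
    exists2 h, P h & h (t *: x) <= t * f x) ->
  sublinear (inf_fun P).
Proof.
move=> P0 mP PD PZ.
have leP f x : P f -> inf_fun P x <= f x.
  by move=> Pf; exact: (inf_fun_le x mP Pf).
have PZ0 t x : 0 <= t -> inf_fun P (t *: x) <= t * inf_fun P x.
  rewrite le_eqVlt => /predU1P[<-|t0].
    have [f Pf] := P0; have [h Ph hx] := PZ f 0 x Pf (lexx _).
    by have := le_trans (leP h _ Ph) hx; rewrite !mul0r.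
  rewrite -ler_pdivrMl//; apply: le_inf_fun => // f Pf.
  rewrite ler_pdivrMl//; have [h Ph] := PZ f t x Pf (ltW t0).
  exact/le_trans/leP.
split=> // x y; rewrite -lerBlDr; apply: le_inf_fun => // f Pf.
rewrite lerBlDr -lerBlDl; apply: le_inf_fun => // g Pg.
rewrite lerBlDl; have [h Ph] := PD f g x y Pf Pg.
exact/le_trans/leP.
Qed.

Definition convex_rel T := forall z1 b1 z2 b2 t, 0 <= t <= 1 ->
  T z1 b1 -> T z2 b2 ->
  T (t *: z1 + (1 - t) *: z2) (t * b1 + (1 - t) * b2).

(** The relation [T] lists constraints [b <= f z] wanted for a linear [f <=
    p]. The largest sublinear function that enforces them is the infimum of [p
    (x + l *: z) - l * b] over [l >= 0] and [T z b]; it is finite exactly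
    because the constraints are compatible with [p], and sublinear because
    they form a convex family. *)
Lemma sublinear_reduce p T z0 b0 : sublinear p -> convex_rel T ->
  T z0 b0 -> (forall z b, T z b -> b <= p z) ->
  exists q, [/\ sublinear q, forall x, q x <= p x &
                forall z b, T z b -> q (- z) <= - b].
Proof.
move=> sp cT T0 Tp.
pose F (l : R) z b := fun x => p (x + l *: z) - l * b.
pose P := [set f | exists l z b, [/\ 0 <= l, T z b & f = F l z b]].
have mP f x : P f -> - p (- x) <= f x.
  move=> [l [z [b [l0 Tzb ->]]]]; rewrite /F.
  have := sp.1 (- x) (x + l *: z); rewrite addKr sublinearZ//.
  by have := ler_wpM2l l0 (Tp _ _ Tzb); lra.
have PF l z b : 0 <= l -> T z b -> P (F l z b) by move=> *; exists l, z, b.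
exists (inf_fun P); split.
- apply: (sublinear_inf _ mP).
  + by exists (F 0 z0 b0); exact: PF.
  + move=> _ _ x y [l1 [z1 [b1 [l10 T1 ->]]]] [l2 [z2 [b2 [l20 T2 ->]]]].
    have [l0|l0] := eqVneq (l1 + l2) 0.
      have [-> ->] : l1 = 0 /\ l2 = 0 by split; lra.
      exists (F 0 z1 b1); first exact: PF.
      by rewrite /F !scale0r !addr0 !mul0r !subr0; exact: sp.1.
    have lp : 0 < l1 + l2 by rewrite lt_neqAle eq_sym l0 addr_ge0.
    pose t := l1 / (l1 + l2).
    have t1 : 1 - t = l2 / (l1 + l2) by rewrite /t; field.
    exists (F (l1 + l2) (t *: z1 + (1 - t) *: z2) (t * b1 + (1 - t) * b2)).
      apply: PF; [exact: ltW|apply: cT => //].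
      by rewrite -[t <= 1]subr_ge0 t1 !divr_ge0// ltW.
    rewrite /F t1 /t scalerDr !scalerA ![(l1 + l2) * _]mulrC !divfK//.
    have -> : (l1 / (l1 + l2) * b1 + l2 / (l1 + l2) * b2) * (l1 + l2) =
      l1 * b1 + l2 * b2 by field.
    by rewrite addrACA; have := sp.1 (x + l1 *: z1) (y + l2 *: z2); lra.
  + move=> _ t x [l [z [b [l0 Tzb ->]]]] t0.
    exists (F (t * l) z b); first by apply: PF => //; exact: mulr_ge0.
    by rewrite /F -scalerA -scalerDr sublinearZ// mulrBr mulrA.
- move=> x; apply: le_trans (inf_fun_le x mP (PF 0 z0 b0 (lexx _) T0)) _.
  by rewrite /F scale0r addr0 mul0r subr0.
- move=> z b Tzb; apply: le_trans (inf_fun_le _ mP (PF 1 z b ler01 Tzb)) _.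
  by rewrite /F scale1r addNr sublinear0// mul1r sub0r.
Qed.

(** Zorn's lemma: the pointwise infimum of a chain below [p] is bounded below
    by [- p (- x)]. *)
Lemma sublinear_minimal p : sublinear p ->
  exists q, [/\ sublinear q, forall x, q x <= p x &
    forall r, sublinear r -> (forall x, r x <= q x) -> r = q].
Proof.
move=> sp.
pose S := {q : X -> R | sublinear q /\ forall x, q x <= p x}.
pose mk q (sq : sublinear q) (qp : forall x, q x <= p x) : S :=
  exist (fun q => sublinear q /\ forall x, q x <= p x) q (conj sq qp).
pose le (q r : S) := `[< forall x, sval r x <= sval q x >].
have [|||A Atot|[q [sq qp]] qmin] := @Zorn S le.
- by move=> q; apply/asboolP.
- by move=> q r s /asboolP qr /asboolP rs; apply/asboolP => x;
    exact: le_trans (rs x) (qr x).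
- move=> [q hq] [r hr] /asboolP qr /asboolP rq; apply/eq_exist/funext => x.
  by apply/le_anti; rewrite rq qr.
- have [[s0 As0]|A0] := pselect (A !=set0); last first.
    exists (mk _ sp (fun=> lexx _)) => s As.
    by case: A0; exists s.
  pose P := [set sval s | s in A].
  have mP f x : P f -> - p (- x) <= f x.
    move=> [[q [sq qp]] _ <-] /=; apply: le_trans (sublinear_ge x sq).
    by rewrite lerN2.
  have sP : sublinear (inf_fun P).
    apply: (sublinear_inf _ mP); first by exists (sval s0), s0.
    + move=> _ _ x y [[q [sq qp]] Aq <-] [[r [sr rp]] Ar <-] /=.
      have [/asboolP/= qr|/asboolP/= rq] := Atot _ _ Aq Ar.
      * exists r; first by exists (mk _ sr rp).
        by apply: le_trans (sr.1 _ _) _; rewrite lerD2r.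
      * exists q; first by exists (mk _ sq qp).
        by apply: le_trans (sq.1 _ _) _; rewrite lerD2l.
    + move=> _ t x [[q [sq qp]] Aq <-] t0 /=.
      exists q; first by exists (mk _ sq qp).
      exact: sq.2.
  have Pp x : inf_fun P x <= p x.
    apply: le_trans (inf_fun_le x mP _) ((svalP s0).2 x).
    by exists s0.
  exists (mk _ sP Pp) => s As; apply/asboolP => x /=.
  by apply: (inf_fun_le x mP); exists s.
- exists q; split=> // r sr rq.
  have rp x : r x <= p x by exact: le_trans (rq x) (qp x).
  have /(_ _)/(congr1 sval) := qmin (mk _ sr rp).
  by apply; apply/asboolP.
Qed.

(** A minimal sublinear function [q] is linear: imposing the single constraint
    [q y <= f y] cannot lower it, hence [q (- y) = - q y], and an odd
    sublinear function is linear. *)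
Lemma hahn_banach p : sublinear p ->
  exists f : {linear X -> R^o}, forall x, f x <= p x.
Proof.
move=> /sublinear_minimal[q [sq qp qmin]].
have qN y : q (- y) = - q y.
  have [|||r [sr rq rT]] := @sublinear_reduce q
    (fun z b => z = y /\ b = q y) y (q y) sq.
  - move=> z1 b1 z2 b2 t _ [-> ->] [-> ->]; split.
      by rewrite -scalerDl addrC subrK scale1r.
    by rewrite -mulrDl addrC subrK mul1r.
  - by [].
  - by move=> z b [-> ->].
  have rE := qmin r sr rq; apply/le_anti; rewrite -{1}rE rT//=.
  by have := sublinear_ge y sq; lra.
have qD x y : q (x + y) = q x + q y.
  apply/le_anti; rewrite sq.1/=.
  have := sq.1 (- x) (- y); rewrite -opprD !qN; lra.
have qZ t x : q (t *: x) = t * q x.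
  have [t0|t0] := leP 0 t; first by rewrite sublinearZ.
  by rewrite -[t]opprK scaleNr qN sublinearZ ?mulNr// oppr_ge0 ltW.
have qlin : linear (q : X -> R^o) by move=> t x y; rewrite qD qZ.
pose L := GRing.isLinear.Build _ _ _ _ (q : X -> R^o) qlin.
pose f : {linear X -> R^o} := HB.pack (q : X -> R^o) L.
by exists f.
Qed.

End Sublinear.

(** A convex family of constraints [b <= f z] that are each compatible with
    the norm can be met simultaneously by one functional of norm at most one.
    Every functional used below, be it norming, separating or tailor-made,
    comes from this statement. *)
Lemma mazur_orlicz (R : realType) (X : normedModType R) (T : X -> R -> Prop)
    z0 b0 : convex_rel T -> T z0 b0 -> (forall z b, T z b -> b <= `|z|) ->
  exists f : {linear X -> R^o},
    (forall x, `|f x| <= `|x|) /\ (forall z b, T z b -> b <= f z).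
Proof.
move=> cT T0 Tn.
have sn : sublinear (fun x : X => `|x|).
  by split=> [|t x t0]; [exact: ler_normD|rewrite normrZ ger0_norm].
have [q [sq qn qT]] := sublinear_reduce sn cT T0 Tn.
have [f fq] := hahn_banach sq.
have fn x : f x <= `|x| by exact: le_trans (fq x) (qn x).
exists f; split=> [x|z b Tzb].
  by rewrite ler_norml fn andbT; have := fn (- x); rewrite linearN normrN lerNl.
by have := le_trans (fq (- z)) (qT _ _ Tzb); rewrite linearN lerN2.
Qed.

Section Functionals.
Variables (R : realType) (X : normedModType R).
Implicit Types (f g h : {linear X -> R^o}) (x y z u c : X).

Lemma linear_comb (a : R) f (b : R) g :
  exists h : {linear X -> R^o}, forall x, h x = a * f x + b * g x.
Proof.
pose k : X -> R^o := fun x => a * f x + b * g x.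
have L : linear k.
  by move=> t x y; rewrite /k (linearP f) (linearP g) /GRing.scale/=; ring.
pose kL := GRing.isLinear.Build _ _ _ _ k L.
pose h : {linear X -> R^o} := HB.pack k kL.
by exists h.
Qed.

Lemma norming z :
  exists f, (forall x, `|f x| <= `|x|) /\ f z = `|z|.
Proof.
have [|||f [fn fz]] := @mazur_orlicz R X (fun y b => y = z /\ b = `|z|) z `|z|.
- move=> z1 b1 z2 b2 t _ [-> ->] [-> ->]; split.
    by rewrite -scalerDl addrC subrK scale1r.
  by rewrite -mulrDl addrC subrK mul1r.
- by [].
- by move=> y b [-> ->].
exists f; split=> //; apply/le_anti; rewrite (fz z `|z|)// andbT.
exact: le_trans (ler_norm _) (fn z).
Qed.

Definition convex_closed (Q : set X) := forall c1 c2 (t : R), 0 <= t <= 1 ->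
  Q c1 -> Q c2 -> Q (t *: c1 + (1 - t) *: c2).

(** The constraints are [d <= f (z - c)] for [c] in [Q]. *)
Lemma separate_point (Q : set X) z (d : R) : convex_closed Q -> Q !=set0 ->
  (forall c, Q c -> d <= `|z - c|) ->
  exists f, (forall x, `|f x| <= `|x|) /\ (forall c, Q c -> f c + d <= f z).
Proof.
move=> cQ [c0 Qc0] dQ.
have [|||f [fn fz]] :=
  @mazur_orlicz R X (fun y b => b = d /\ exists2 c, Q c & y = z - c) (z - c0) d.
- move=> _ _ _ _ t t01 [-> [c1 Q1 ->]] [-> [c2 Q2 ->]]; split; first by ring.
  exists (t *: c1 + (1 - t) *: c2); first exact: cQ.
  by rewrite !scalerBr addrACA -scalerDl subrKC scale1r -opprD.
- by split=> //; exists c0.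
- by move=> _ _ [-> [c Qc ->]]; exact: dQ.
exists f; split=> // c Qc.
have : d <= f (z - c) by apply: fz; split=> //; exists c.
by rewrite linearB/= -lerBrDl [f z - _]addrC; lra.
Qed.

Lemma linear_continuousW f (C : R) : (forall x, `|f x| <= C * `|x|) ->
  continuous f.
Proof.
move=> fC; apply: bounded_linear_continuous; apply/linear_boundedP.
near=> r => x; apply: le_trans (fC x) _; by apply: ler_wpM2r.
Unshelve. all: by end_near. Qed.

Lemma continuous_linearW f : continuous f ->
  exists2 C : R, 0 < C & forall x, `|f x| <= C * `|x|.
Proof.
by move=> /linear_bounded_continuous/linear_boundedP/pinfty_ex_gt0[C C0 fC];
  exists C.
Qed.

End Functionals.

(** * The Daugavet property on slices of the unit ball *)
Section Daugavet.
Variables (R : realType) (X : normedModType R) (e : X).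
Hypotheses (e1 : `|e| = 1) (hD : Daugavet_property X).
Implicit Types (f g h : {linear X -> R^o}) (x y z u c : X).

(** The Daugavet equation for the operator sending [x] to [h x *: x0], where
    [h] has norm one, yields a unit ball point at which the norm is almost
    two; its sign can be chosen. *)
Lemma daugavet_norm h x0 (de : R) :
  (forall x, `|x| <= 1 -> `|h x| <= 1) ->
  (forall t : R, t < 1 -> exists2 x : X, `|x| <= 1 & t < `|h x|) ->
  `|x0| = 1 -> 0 < de ->
  exists2 x : X, `|x| <= 1 & 2 - de < `|x + h x *: x0| /\ 0 <= h x.
Proof.
move=> h1 hsup x01 de0.
have L : linear (fun x => h x *: x0).
  by move=> t x y; rewrite linearP/= scalerDl -scalerA.
pose TL := GRing.isLinear.Build _ _ _ _ (fun x => h x *: x0) L.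
pose T : {linear X -> X} := HB.pack (fun x => h x *: x0) TL.
have TE x : T x = h x *: x0 by [].
have Tn x : `|x| <= 1 -> `|T x| <= 1.
  by move=> x1; rewrite TE normrZ x01 mulr1 h1.
have hn x : `|h x| <= 1 * `|x|.
  have [->|x0'] := eqVneq x 0; first by rewrite linear0 !normr0 mulr0.
  have nx : 0 < `|x| by rewrite normr_gt0.
  have : `|h (`|x|^-1 *: x)| <= 1.
    by apply: h1; rewrite normrZ normfV normr_id mulVf// gt_eqF.
  by rewrite linearZ/= normrM normfV normr_id mulrC ler_pdivrMr.
have Tb : bounded_near T (nbhs (0 : X)).
  apply/linear_boundedP; near=> r => x; rewrite TE normrZ x01 mulr1.
  apply: le_trans (hn x) _; by apply: ler_wpM2r.
have [xh _ hx0] := hsup 0 ltr01.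
have Tr : rank_one T.
  exists x0; first by rewrite -normr_eq0 x01 oner_eq0.
  apply/seteqP; split=> _ [a _ <-]; first by exists (h a).
  have hxh : h xh != 0 by rewrite -normr_gt0.
  exists ((a / h xh) *: xh) => //.
  by rewrite TE linearZ/= /GRing.scale/= divfK.
have := hD Tb Tr; rewrite /opnorm => hDT.
have T1 : 1 - de / 2 < sup [set `|T x| | x in [set x : X | `|x| <= 1]].
  have [|x x1 hx] := hsup (1 - de / 2); first by rewrite ltrBlDr ltrDl divr_gt0.
  apply: lt_le_trans hx _; apply: ub_le_sup.
    by exists 1 => _ [y y1 <-]; exact: Tn.
  by exists x => //; rewrite TE normrZ x01 mulr1.
have [||_ [x x1 <-]] := @sup_adherent R
  [set `|x + T x| | x in [set x : X | `|x| <= 1]] (de / 2).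
- by rewrite divr_gt0.
- split; first by exists `|0 + T 0|, 0 => //=; rewrite normr0.
  exists 2 => _ [y y1 <-]; apply: le_trans (ler_normD _ _) _.
  by have := Tn _ y1; move: y1 => /=; lra.
rewrite hDT => xT.
have xT2 : 2 - de < `|x + h x *: x0| by rewrite -TE; lra.
have [hx|hx] := leP 0 (h x); first by exists x.
exists (- x); first by rewrite normrN.
by rewrite linearN/= scaleNr -opprD normrN oppr_ge0 ltW.
Unshelve. all: by end_near. Qed.

(** If [x + k x *: x0] has norm almost two for the normalization [k] of [h],
    and [phi] norms this vector, then [phi x], [phi x0] and [k x] are all
    almost one. A point of the ball where [phi + k] is almost two therefore
    lies deep in the given slice, and [phi] witnesses that its norm adds up
    with that of [u]. *)
Lemma daugavet_subslice h (C al : R) u (eps : R) :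
  (forall x, `|h x| <= C * `|x|) -> 0 <= al ->
  (exists2 x : X, `|x| <= 1 & al < h x) -> 0 < eps ->
  exists (h' : {linear X -> R^o}) (al' : R),
  [/\ forall x, `|h' x| <= 2 * `|x|, 0 <= al',
      exists2 x : X, `|x| <= 1 & al' < h' x &
      forall x, `|x| <= 1 -> al' < h' x ->
        al < h x /\ `|u| + 1 - eps <= `|u + x| ].
Proof.
move=> hC al0 [x1 x11 hx1] eps0.
pose S := [set `|h x| | x in [set x : X | `|x| <= 1]].
have Sub : has_ubound S.
  exists `|C| => _ [x x1' <-]; apply: le_trans (hC x) _.
  apply: le_trans (ler_wpM2r _ (ler_norm C)) _ => //.
  by rewrite ler_piMr.
have SH x : `|x| <= 1 -> `|h x| <= sup S.
  by move=> xx; apply: ub_le_sup => //; exists x.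
have HS : has_sup S by split=> //; exists `|h x1|, x1.
pose H := sup S.
have alH : al < H.
  by apply: lt_le_trans hx1 _; apply: le_trans (ler_norm _) (SH _ x11).
have H0 : 0 < H by exact: le_lt_trans alH.
have [k kE] := linear_comb H^-1 h 0 h.
have {}kE x : k x = H^-1 * h x by rewrite kE mul0r addr0.
have kn x : `|x| <= 1 -> `|k x| <= 1.
  by move=> x1'; rewrite kE normrM gtr0_norm ?invr_gt0// ler_pdivrMl// mulr1 SH.
have ksup (t : R) : t < 1 -> exists2 x : X, `|x| <= 1 & t < `|k x|.
  move=> t1; have [||_ [x x1' <-] xH] := @sup_adherent _ S ((1 - t) * H).
  - by rewrite mulr_gt0// subr_gt0.
  - by [].
  exists x => //; rewrite kE normrM gtr0_norm ?invr_gt0// ltr_pdivlMl//.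
  by rewrite -/H in xH; lra.
pose x0 := if u == 0 then e else `|u|^-1 *: u.
have x01 : `|x0| = 1.
  rewrite /x0; case: eqVneq => // u0.
  by rewrite normrZ normfV normr_id mulVf// normr_eq0.
have ux0 : u = `|u| *: x0.
  rewrite /x0; case: eqVneq => [->|u0]; first by rewrite normr0 scale0r.
  by rewrite scalerA mulfV ?scale1r// normr_eq0.
(* The three bounds serve the inclusion in the given slice, the estimate on [u
   + x], and the nonnegativity of the new threshold. *)
pose de := Num.min ((H - al) / (4 * H)) (Num.min (eps / (2 * `|u| + 4)) 4^-1).
have u4 : 0 < 2 * `|u| + 4 by rewrite ltr_wpDl// mulr_ge0.
have H4 : 0 < 4 * H by rewrite mulr_gt0.
have de0 : 0 < de.
  by rewrite !lt_min !divr_gt0 ?subr_gt0//= invr_gt0.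
have de1 : 4 * H * de <= H - al.
  by rewrite mulrC -ler_pdivlMr// /de ge_min lexx.
have de2 : de * (2 * `|u| + 4) <= eps.
  by rewrite -ler_pdivlMr// /de !ge_min lexx orbT.
have de3 : de <= 4^-1 by rewrite /de !ge_min lexx !orbT.
have [x xn [xk kx0]] := daugavet_norm kn ksup x01 de0.
have [phi [phin phix]] := norming (x + k x *: x0).
rewrite -phix linearD linearZ/= /GRing.scale/= in xk.
have pl y : phi y <= `|y| by exact: le_trans (ler_norm _) (phin y).
have px := pl x; have px0 := pl x0; rewrite x01 in px0.
have kx1 : k x <= 1 by exact: le_trans (ler_norm _) (kn _ xn).
have kp : k x * phi x0 <= k x by rewrite ler_piMr.
have px0' : 1 - de < phi x0.
  have p0 : 0 <= phi x0.
    rewrite leNgt; apply/negP => p0.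
    have : k x * phi x0 <= 0 by rewrite mulr_ge0_le0// ltW.
    lra.
  have : k x * phi x0 <= phi x0 by rewrite ler_piMl.
  lra.
have [h' h'E] := linear_comb 1 phi 1 k.
have {}h'E y : h' y = phi y + k y by rewrite h'E !mul1r.
have kb y : `|k y| <= `|y|.
  have [->|y0'] := eqVneq y 0; first by rewrite linear0 !normr0.
  have ny : 0 < `|y| by rewrite normr_gt0.
  have : `|k (`|y|^-1 *: y)| <= 1.
    by apply: kn; rewrite normrZ normfV normr_id mulVf// gt_eqF.
  by rewrite linearZ/= normrM normfV normr_id ler_pdivrMl// mulr1.
exists h', (2 - 2 * de); split.
- move=> y; rewrite h'E; apply: le_trans (ler_normD _ _) _.
  by have := phin y; have := kb y; lra.
- lra.
- exists x => //; rewrite h'E; lra.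
- move=> y y1; rewrite h'E => hy.
  have ky : k y <= 1 by exact: le_trans (ler_norm _) (kn _ y1).
  have py : phi y <= 1 by exact: le_trans (pl _) y1.
  split.
    have : 1 - 2 * de < k y by lra.
    rewrite kE ltr_pdivlMl// => hyH.
    have : 0 < H * de by rewrite mulr_gt0.
    lra.
  have := pl (u + y); rewrite linearD/= [in phi u]ux0 linearZ/=.
  rewrite /GRing.scale/= => uy.
  have : `|u| * (1 - de) <= `|u| * phi x0 by apply: ler_wpM2l => //; exact: ltW.
  lra.
Qed.

(** Subslices can be nested, so finitely many vectors are handled one after
    the other. *)
Lemma daugavet_finite h (C al : R) (N : seq X) (eps : R) :
  (forall x, `|h x| <= C * `|x|) -> 0 <= al ->
  (exists2 x : X, `|x| <= 1 & al < h x) -> 0 < eps ->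
  exists x, [/\ `|x| <= 1, al < h x &
    forall u, u \in N -> `|u| + 1 - eps <= `|u + x|].
Proof.
move=> hC al0 hx eps0.
elim: N h C al hC al0 hx => [|v N IH] h C al hC al0 hx.
  by have [x x1 xh] := hx; exists x.
have [h' [al' [h'C al'0 h'x sub]]] := daugavet_subslice v hC al0 hx eps0.
have [x [x1 xh xN]] := IH _ _ _ h'C al'0 h'x.
have [hx' xv] := sub x x1 xh.
by exists x; split=> // u; rewrite inE => /predU1P[->|/xN].
Qed.

End Daugavet.

(** * Absolutely convex hulls of finite lists *)
Section Hull.
Variables (R : realType) (X : normedModType R).
Implicit Types (L N F : seq X) (u v w : X) (A B c : R).

(** The linear combinations of [L] whose coefficients have absolute values of
    sum at most [A]. *)
Fixpoint hull L A : set X := if L is v :: L' then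
    [set u | exists c u', [/\ u = c *: v + u', `|c| <= A &
      hull L' (A - `|c|) u']]
  else [set u | u = 0 /\ 0 <= A].

Lemma hull_le L A B u : A <= B -> hull L A u -> hull L B u.
Proof.
elim: L A B u => [|v L IH] A B u AB /=.
  by move=> [-> A0]; split=> //; lra.
move=> [c [u' [-> cA u'A]]]; exists c, u'; split=> //; first by lra.
by apply: IH u'A; lra.
Qed.

Lemma hull0 L A : 0 <= A -> hull L A 0.
Proof.
elim: L => //= v L IH A0; exists 0, 0; rewrite normr0 scale0r addr0 subr0.
by split=> //; exact: IH.
Qed.

Lemma hullD L A B u v : hull L A u -> hull L B v -> hull L (A + B) (u + v).
Proof.
elim: L A B u v => [|w L IH] A B u v /=.
  by move=> [-> A0] [-> B0]; rewrite addr0 addr_ge0.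
move=> [c [u' [-> cA u'A]]] [d [v' [-> dB v'B]]].
exists (c + d), (u' + v'); rewrite scalerDl addrACA; split=> //.
  by have := ler_normD c d; lra.
by apply: hull_le (IH _ _ _ _ u'A v'B); have := ler_normD c d; lra.
Qed.

Lemma hullZ L A u (t : R) : hull L A u -> hull L (`|t| * A) (t *: u).
Proof.
elim: L A u => [|w L IH] A u /=.
  by move=> [-> A0]; rewrite scaler0 mulr_ge0.
move=> [c [u' [-> cA u'A]]]; exists (t * c), (t *: u').
rewrite scalerDr scalerA normrM; split=> //; first exact: ler_wpM2l.
by rewrite -mulrBr; exact: IH.
Qed.

Lemma hullN L A u : hull L A u -> hull L A (- u).
Proof. by move=> /(hullZ (-1)); rewrite normrN1 mul1r scaleN1r. Qed.

Lemma hull_mem L A v c : v \in L -> `|c| <= A -> hull L A (c *: v).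
Proof.
elim: L => //= w L IH; rewrite inE => /predU1P[<-|vL] cA.
  by exists c, 0; rewrite addr0; split=> //; apply: hull0; rewrite subr_ge0.
exists 0, (c *: v); rewrite normr0 scale0r add0r subr0; split=> //.
  exact: le_trans cA.
exact: IH.
Qed.

Lemma hull_sub L L' A u : {subset L <= L'} -> hull L A u -> hull L' A u.
Proof.
elim: L A u => [|v L IH] A u LL' /=; first by move=> [-> ?]; exact: hull0.
move=> [c [u' [-> cA u'A]]]; rewrite -[A](subrKC `|c|); apply: hullD.
  by apply: hull_mem => //; apply: LL'; rewrite mem_head.
by apply: IH u'A => w wL; apply: LL'; rewrite inE wL orbT.
Qed.

Lemma hull_norm L A u : (forall v, v \in L -> `|v| <= 1) -> hull L A u ->
  `|u| <= A.
Proof.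
elim: L A u => [|v L IH] A u L1 /=; first by move=> [-> ?]; rewrite normr0.
move=> [c [u' [-> cA u'A]]]; apply: le_trans (ler_normD _ _) _.
have : `|c *: v| <= `|c|.
  by rewrite normrZ ler_piMr//; apply: L1; rewrite mem_head.
have : `|u'| <= A - `|c|.
  by apply: IH u'A => w wL; apply: L1; rewrite inE wL orbT.
lra.
Qed.

Definition totally_bounded (Q : set X) := forall d : R, 0 < d ->
  exists N, forall u, Q u -> exists2 u', u' \in N & `|u - u'| <= d.

Lemma interval_net A (d : R) : 0 < d ->
  exists G : seq R, forall c, `|c| <= A ->
    exists2 c', c' \in G & `|c - c'| <= d.
Proof.
move=> d0.
exists [seq - A + d * i%:R | i <- iota 0 (Num.truncn (2 * A / d)).+1] => c cA.
have cA0 : 0 <= (c + A) / d.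
  by apply: divr_ge0; [move: cA; rewrite ler_norml; lra|exact: ltW].
exists (- A + d * (Num.truncn ((c + A) / d))%:R).
  apply/mapP; exists (Num.truncn ((c + A) / d)) => //.
  rewrite mem_iota/= add0n ltnS le_truncn// ler_pM2r ?invr_gt0//.
  by move: cA; rewrite ler_norml; lra.
have := truncn_itv cA0; rewrite -[_.+1%:R]natr1.
set k := _%:R; move=> /andP[].
rewrite ler_pdivlMr// ltr_pdivrMr// => k1 k2; rewrite ler_norml; lra.
Qed.

Lemma hull_totally_bounded L A : totally_bounded (hull L A).
Proof.
elim: L A => [|v L IH] A d d0.
  by exists [:: 0] => u [-> _]; exists 0; rewrite ?inE// subrr normr0 ltW.
have d20 : 0 < d / 2 by rewrite divr_gt0.
have v0 : 0 < `|v| + 1 by rewrite ltr_wpDl.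
have [N NP] := IH A _ d20.
have [G GP] := interval_net A (divr_gt0 d20 v0).
exists [seq c *: v + u | c <- G, u <- N] => u /= [c [u' [-> cA u'A]]].
have [c' c'G cc'] := GP c cA.
have [|w wN u'w] := NP u'; first by apply: hull_le u'A; rewrite gerBl.
exists (c' *: v + w); first by apply/allpairsP; exists (c', w).
rewrite opprD addrACA -scalerBl; apply: le_trans (ler_normD _ _) _.
suff : `|(c - c') *: v| <= d / 2 by lra.
rewrite normrZ; rewrite ler_pdivlMr// in cc'.
by apply: le_trans cc'; rewrite ler_wpM2l// lerDl.
Qed.

End Hull.

(** * Children: convex decompositions into almost l1-orthogonal points *)
Section Children.
Variables (R : realType) (X : normedModType R) (e : X).
Hypotheses (e1 : `|e| = 1) (hD : Daugavet_property X).
Implicit Types (f g h : {linear X -> R^o}) (x y z u c w : X) (F N : seq X).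

(** Almost l1-orthogonality, with an additive error: over a bounded set [Q] it
    can be tested on a finite net, which a relative error would not allow near
    the origin. *)
Definition orth (eps : R) (Q : set X) y :=
  forall u, Q u -> `|u| + 1 - eps <= `|u + y|.

(** Since [u + y] differs from [u + t *: y] by [(1 - t) *: y], the case [t =
    1] implies the others. *)
Lemma orth_scale (ep t : R) (Q : set X) y u : (forall v, Q v -> Q (- v)) ->
  `|y| <= 1 -> orth ep Q y -> `|t| <= 1 -> Q u ->
  `|u| + `|t| - ep <= `|u + t *: y|.
Proof.
move=> QN y1 oy; wlog t0 : t u / 0 <= t.
  move=> H t1 Qu; have [t0|t0] := leP 0 t; first exact: H.
  have := H (- t) (- u); rewrite !normrN scaleNr -opprD normrN.
  by apply => //; [rewrite oppr_ge0 ltW|exact: QN].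
move=> t1 Qu; have := oy u Qu; rewrite ger0_norm// in t1 *.
have -> : u + y = u + t *: y + (1 - t) *: y.
  by rewrite -addrA -scalerDl subrKC scale1r.
have := ler_normD (u + t *: y) ((1 - t) *: y).
rewrite normrZ ger0_norm ?subr_ge0//.
have : (1 - t) * `|y| <= 1 - t by rewrite ler_piMr// subr_ge0.
lra.
Qed.

(** By Hahn-Banach this says that [y] is a convex combination of [F]; in this
    form no coefficients have to be carried along. *)
Definition dominated F y := forall f, exists2 c, c \in F & f y <= f c.

Lemma dominated_convex (Q : set X) :
  convex_closed [set y | exists2 F, (forall c, c \in F -> Q c) & dominated F y].
Proof.
move=> y1 y2 t /andP[t0 t1] [F1 F1Q d1] [F2 F2Q d2].
exists (F1 ++ F2) => [c|f]; first by rewrite mem_cat => /orP[/F1Q|/F2Q].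
have [c1 c1F f1] := d1 f; have [c2 c2F f2] := d2 f.
rewrite linearD !linearZ/= /GRing.scale/=.
have : t * f y1 <= t * f c1 by exact: ler_wpM2l.
have : (1 - t) * f y2 <= (1 - t) * f c2 by apply: ler_wpM2l => //; lra.
have [c12|c12] := leP (f c1) (f c2).
  exists c2; first by rewrite mem_cat c2F orbT.
  have : t * f c1 <= t * f c2 by exact: ler_wpM2l.
  lra.
exists c1; first by rewrite mem_cat c1F.
have : (1 - t) * f c2 <= (1 - t) * f c1 by apply: ler_wpM2l; lra.
lra.
Qed.

(** A functional separating [z] from all convex combinations of points almost
    orthogonal to [N] would define a slice of the ball without such points,
    which [daugavet_finite] excludes. *)
Lemma approx_dominated N z (eps d : R) : `|z| <= 1 -> 0 < eps -> 0 < d ->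
  exists y F, [/\ `|z - y| < d, dominated F y &
    forall c, c \in F -> `|c| <= 1 /\ orth eps [set` N] c].
Proof.
move=> z1 eps0 d0.
pose Q : set X := [set c | `|c| <= 1 /\ orth eps [set` N] c].
pose Q' := [set y | exists2 F, (forall c, c \in F -> Q c) & dominated F y].
have QQ' c : Q c -> Q' c.
  move=> Qc; exists [:: c] => [c'|f]; first by rewrite inE => /eqP ->.
  by exists c; rewrite ?inE.
have find h (al : R) : (forall x, `|h x| <= `|x|) -> 0 <= al ->
    (exists2 x : X, `|x| <= 1 & al < h x) -> exists2 c, Q c & al < h c.
  move=> hn al0 hx.
  have hn1 x : `|h x| <= 1 * `|x| by rewrite mul1r.
  have [x [x1 xh xN]] := daugavet_finite e1 hD N hn1 al0 hx eps0.
  by exists x.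
have [c0 Qc0] : exists c, Q c.
  have [phi [phin phie]] := norming e.
  have [|c Qc _] := find phi 0 phin (lexx _); last by exists c.
  by exists e; rewrite ?e1// phie e1.
have [[y [[F FQ Fy] yz]]|H] := pselect (exists y, Q' y /\ `|z - y| < d).
  by exists y, F.
have [|||f [fn fQ]] := @separate_point R X Q' z d.
- exact: dominated_convex.
- by exists c0; exact: QQ'.
- by move=> c Qc; rewrite leNgt; apply/negP => zc; apply: H; exists c.
exfalso.
have [||c Qc] := find f (Num.max 0 (f z - d)) fn.
- by rewrite le_max lexx.
- have [fz|fz] := ltP 0 (f z).
    by exists z => //; rewrite gt_max fz/=; lra.
  exists (- c0); first by rewrite normrN; exact: Qc0.1.
  by have := fQ _ (QQ' _ Qc0); rewrite gt_max linearN/=; lra.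
by have := fQ _ (QQ' _ Qc); rewrite gt_max => ? /andP[_]; lra.
Qed.

(** The convex combination has to be exactly [z], since the error could not be
    compensated later on. The small error [w] of [approx_dominated] is
    absorbed by translating all the points, and the scaling by [r] makes room
    for this in the open unit ball. *)
Lemma children (Q : set X) z (eps : R) :
  totally_bounded Q -> `|z| < 1 -> 0 < eps ->
  exists2 F, dominated F z & forall c, c \in F -> `|c| < 1 /\ orth eps Q c.
Proof.
move=> tbQ z1 eps0.
pose r := Num.max `|z| (Num.max (1 - eps / 4) (1 / 2)).
have rz : `|z| <= r by rewrite le_max lexx.
have re : 1 - r <= eps / 4.
  suff : 1 - eps / 4 <= r by lra.
  by rewrite !le_max lexx orbT.
have r0 : 1 / 2 <= r by rewrite !le_max lexx !orbT.
have r1 : r < 1 by rewrite !gt_max z1/=; apply/andP; split; lra.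
have rp : 0 < r by lra.
pose d := Num.min (eps / 4) ((1 - r) / 2).
have d0 : 0 < d by rewrite lt_min; apply/andP; split; lra.
have de : d <= eps / 4 by rewrite ge_min lexx.
have dr : d <= (1 - r) / 2 by rewrite ge_min lexx orbT.
have [|N NQ] := tbQ (eps / 8); first by lra.
have [|||y [F [zy Fy FN]]] := @approx_dominated N (r^-1 *: z) (eps / 4) d.
- by rewrite normrZ normfV gtr0_norm// ler_pdivrMl// mulr1.
- lra.
- by [].
pose w := r^-1 *: z - y; rewrite -/w in zy.
exists [seq r *: (c + w) | c <- F] => [f|_ /mapP[c cF ->]].
  have [c cF fc] := Fy f; exists (r *: (c + w)); first exact: map_f.
  have -> : z = r *: (y + w).
    by rewrite /w subrKC scalerA mulfV ?scale1r ?gt_eqF.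
  rewrite !linearZ !linearD/= /GRing.scale/= ler_pM2l//; lra.
have [c1 cN] := FN c cF.
have rw : r * `|w| <= `|w| by rewrite ler_piMl// ltW.
split.
  rewrite normrZ gtr0_norm//.
  have : r * `|c + w| <= r * (1 + `|w|).
    by apply: ler_wpM2l; [exact: ltW|have := ler_normD c w; lra].
  lra.
move=> u Qu; have [u' u'N uu'] := NQ u Qu.
have := cN u' u'N.
set x := r *: (c + w).
have : `|x - c| <= eps / 4 + eps / 4.
  have -> : x - c = r *: w - (1 - r) *: c.
    by rewrite /x scalerDr scalerBl scale1r opprB addrA [r *: w + _]addrC.
  apply: le_trans (ler_normB _ _) _; rewrite !normrZ (gtr0_norm rp).
  have -> : `|1 - r| = 1 - r by rewrite ger0_norm// subr_ge0 ltW.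
  have : (1 - r) * `|c| <= 1 - r by rewrite ler_piMr// subr_ge0 ltW.
  lra.
have -> : u' + c = (u + x) - ((u - u') + (x - c)).
  by rewrite opprD addrACA !subKr.
have := ler_normB (u + x) ((u - u') + (x - c)).
have := ler_normD (u - u') (x - c).
have := ler_normD u' (u - u'); rewrite subrKC.
lra.
Qed.

End Children.

(** * Points that form a slice *)
Section Exposed.
Variables (R : realType) (X : normedModType R).
Implicit Types (f g h : {linear X -> R^o}) (A B : set X).
Implicit Types (x y b : X) (F : seq X).

(** When [A] has another point, this says that the singleton of [x] is a slice
    of [A]. *)
Definition exposed A x := A x /\ exists f (C ga : R),
  [/\ forall y, `|f y| <= C * `|y|, 0 < ga &
      forall y, A y -> y != x -> f y + ga <= f x].

Lemma exposed_sub A B x : B `<=` A -> B x -> exposed A x -> exposed B x.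
Proof.
move=> BA Bx [_ [f [C [ga [fC ga0 fx]]]]]; split=> //; exists f, C, ga.
by split=> // y /BA; exact: fx.
Qed.

Lemma exposed_is_slice A x y : exposed A x -> A y -> y != x ->
  is_slice A [set x].
Proof.
move=> [Ax [f [C [ga [fC ga0 fx]]]]] Ay yx; split; first by exists x.
exists f, ga; split=> //; first exact: linear_continuousW fC.
  by move=> f0; have := fx y Ay yx; rewrite f0/=; lra.
rewrite /slice; have -> : sup [set f a | a in A] = f x.
  have fub : ubound [set f a | a in A] (f x).
    move=> _ [a Aa <-]; have [->//|ax] := eqVneq a x.
    by have := fx a Aa ax; lra.
  apply/le_anti; rewrite ge_sup//=; last by exists (f x), x.
  by apply: ub_le_sup; [exists (f x)|exists x].
apply/seteqP; split=> [_ ->|a [Aa fa]]; first by split=> //; lra.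
by apply: contrapT => /eqP ax; have := fx a Aa ax; lra.
Qed.

Lemma seq_argmax (g : X -> R) F x0 : x0 \in F ->
  exists2 x1, x1 \in F & forall x, x \in F -> g x <= g x1.
Proof.
elim: F x0 => // y F IH x0 _.
have [->|/eqP] := eqVneq F [::].
  by exists y => [|x]; rewrite ?mem_head// inE => /eqP ->.
case: F IH => // y' F IH _; have [x1 x1F x1m] := IH y' (mem_head _ _).
have [xy|xy] := leP (g y) (g x1).
  exists x1; first by rewrite inE x1F orbT.
  by move=> x; rewrite inE => /predU1P[->|/x1m].
exists y; first exact: mem_head.
move=> x; rewrite inE => /predU1P[->//|/x1m].
by move=> /le_trans; apply; exact: ltW.
Qed.

(** A slice with finitely many points contains an exposed point: it can be cut
    down one point at a time, after tilting the functional slightly when it is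
    constant on the points that are left. *)
Lemma finite_slice_exposed A F f (C ga M : R) x0 :
  (forall x, A x -> `|x| <= M) ->
  (forall x, `|f x| <= C * `|x|) -> 0 < ga -> x0 \in F ->
  (forall x, x \in F -> A x) ->
  (forall x, A x -> x \notin F -> f x + ga <= f x0) ->
  exists2 x, x \in F & exposed A x.
Proof.
move=> AM; have [n] := ubnP (size F).
elim: n => // n IH in F f C ga x0 *; rewrite ltnS => sF fC ga0 x0F FA fga.
have separated g (D de : R) : (forall x, `|g x| <= D * `|x|) -> 0 < de ->
    (forall x, A x -> x \notin F -> g x + de <= g x0) ->
    (exists2 b, b \in F & g b != g x0) -> exists2 x, x \in F & exposed A x.
  move=> gD de0 gde [b bF gb].
  have [x1 x1F x1m] := seq_argmax g x0F.
  have [b' b'F gb'] : exists2 b', b' \in F & g b' < g x1.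
    have [bx|bx] := ltP (g b) (g x1); first by exists b.
    exists x0 => //; rewrite lt_neqAle x1m// andbT.
    by apply: contra_neq gb => ->; apply/le_anti; rewrite bx x1m.
  have [||||||x xF xE] := IH [seq x <- F | x != b'] g D
      (Num.min de (g x1 - g b')) x1.
  - apply: leq_trans sF; rewrite -(count_predC (pred1 b') F) size_filter.
    by rewrite -[X in (X < _)%N]add0n ltn_add2r -has_count has_pred1.
  - by [].
  - by rewrite lt_min de0 subr_gt0.
  - by rewrite mem_filter x1F andbT; apply: contraTneq gb' => ->; rewrite ltxx.
  - by move=> x; rewrite mem_filter => /andP[_ /FA].
  - move=> x Ax; rewrite mem_filter negb_and negbK => /orP[/eqP ->|xF].
      have : Num.min de (g x1 - g b') <= g x1 - g b'.
        by rewrite ge_min lexx orbT.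
      lra.
    have : Num.min de (g x1 - g b') <= de by rewrite ge_min lexx.
    by have := gde x Ax xF; have := x1m x0 x0F; lra.
  by exists x => //; move: xF; rewrite mem_filter => /andP[].
have [[b bF bx0]|Fx0] := pselect (exists2 b, b \in F & b != x0); last first.
  exists x0 => //; split; first exact: FA.
  exists f, C, ga; split=> // y Ay yx0; apply: fga => //.
  by apply/negP => yF; apply: Fx0; exists y.
have [fb|fb] := eqVneq (f b) (f x0); last first.
  by apply: (separated f C ga) => //; exists b.
have [h [hn hx]] := norming (x0 - b).
have M0 : 0 <= M by exact: le_trans (AM _ (FA _ x0F)).
pose t := ga / (4 * (M + 1)).
have t0 : 0 < t by rewrite divr_gt0 ?mulr_gt0//; lra.
have tM : t * M <= ga / 4.
  have -> : ga / 4 = t * (M + 1) by rewrite /t; field; lra.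
  by apply: ler_wpM2l; [exact: ltW|lra].
have th x : A x -> `|t * h x| <= ga / 4.
  move=> Ax; apply: le_trans tM; rewrite normrM gtr0_norm//.
  apply: ler_wpM2l; first exact: ltW.
  exact: le_trans (hn x) (AM x Ax).
have [g gE] := linear_comb 1 f t h.
apply: (separated g (C + t) (ga / 2)); last 1 first.
- exists b => //; rewrite !gE fb (inj_eq (addrI _)).
  rewrite (inj_eq (mulfI _)) ?(gt_eqF t0)//.
  by rewrite lt_eqF// -subr_gt0 -linearB hx normr_gt0 subr_eq0 eq_sym.
- move=> x; rewrite gE mul1r mulrDl; apply: le_trans (ler_normD _ _) _.
  by rewrite lerD// normrM gtr0_norm// ler_pM2l.
- by rewrite divr_gt0.
- move=> x Ax xF; rewrite !gE !mul1r; have := fga x Ax xF.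
  have := th x Ax; have := th x0 (FA _ x0F); rewrite !ler_norml; lra.
Qed.

End Exposed.

(** * The functional adapted to a level *)
Section Selection.
Variables (R : realType) (X : normedModType R) (e : X).
Hypothesis e1 : `|e| = 1.
Implicit Types (f g h : {linear X -> R^o}) (x y z u v : X) (E F : seq X).

(** Since [y] is almost l1-orthogonal to [e] and [E], a functional of norm one
    can almost norm [y] and still have values prescribed independently, and
    with some loss, at [e] and on [E]. The values are imposed through lower
    bounds at the vectors [y - (u + t *: e)] with [u] in the hull of [E]. *)
Lemma select_functional E y (eps : R) : (forall v, v \in E -> `|v| <= 1) ->
  `|y| <= 1 -> orth eps (hull (e :: E) 32) y ->
  exists g, [/\ forall x, `|g x| <= `|x|, 1 - eps <= g y,
    g e <= - 4^-1 + eps & forall v, v \in E -> g v <= 2^-1 + eps].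
Proof.
move=> E1 y1 oy.
pose T z (b : R) := exists u (A t : R), [/\ hull E A u, 0 <= t, A + t <= 1,
  z = y - (u + t *: e) & b = 1 - eps - A / 2 + t / 4].
have [|||g [gn gT]] := @mazur_orlicz R X T (y - (0 + 0 *: e))
  (1 - eps - 0 / 2 + 0 / 4).
- move=> _ _ _ _ t /andP[t0 t1] [u1 [A1 [t1' [u1A t10 At1 -> ->]]]]
    [u2 [A2 [t2' [u2A t20 At2 -> ->]]]].
  have s0 : 0 <= 1 - t by rewrite subr_ge0.
  exists (t *: u1 + (1 - t) *: u2), (t * A1 + (1 - t) * A2),
    (t * t1' + (1 - t) * t2'); split.
  + have := hullD (hullZ t u1A) (hullZ (1 - t) u2A).
    by rewrite !ger0_norm.
  + by rewrite addr_ge0// mulr_ge0.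
  + have : t * (A1 + t1') <= t * 1 by exact: ler_wpM2l.
    have : (1 - t) * (A2 + t2') <= (1 - t) * 1 by exact: ler_wpM2l.
    lra.
  + rewrite !scalerBr !scalerDr !scalerA addrACA -scalerDl subrKC scale1r.
    by rewrite -opprD; congr (_ - _); rewrite addrACA -scalerDl.
  + by field.
- by exists 0, 0, 0; split; [exact: hull0|exact: lexx|lra|by []|by []].
- move=> _ _ [u [A [t [uA t0 At -> ->]]]].
  have ute : hull (e :: E) 32 (- (u + t *: e)).
    rewrite -scaleN1r; apply: (@hull_le _ _ _ (`|-1| * (A + t))).
      by rewrite normrN1; lra.
    apply: hullZ; apply: hullD.
      by apply: hull_sub uA => w wE; rewrite inE wE orbT.
    by apply: hull_mem; rewrite ?mem_head// ger0_norm.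
  have := oy _ ute; rewrite normrN [_ + y]addrC.
  have uA' := hull_norm E1 uA.
  have : t - A <= `|u + t *: e|.
    have := ler_normB (u + t *: e) u.
    rewrite addrAC subrr add0r normrZ e1 mulr1.
    by rewrite ger0_norm//; lra.
  have := normr_ge0 (u + t *: e); lra.
have gl x : g x <= `|x| by exact: le_trans (ler_norm _) (gn x).
have gy := gl y.
have gP u A t : hull E A u -> 0 <= t -> A + t <= 1 ->
    1 - eps - A / 2 + t / 4 <= g y - (g u + t * g e).
  move=> uA t0 At; have : T (y - (u + t *: e)) (1 - eps - A / 2 + t / 4).
    by exists u, A, t.
  by move=> /gT; rewrite linearB [g (u + _)]linearD [g (t *: e)]linearZ.
have g0 := linear0 g.
exists g; split=> [//|||v vE].
- have := gP 0 0 0 (hull0 _ (lexx _)) (lexx _).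
  by rewrite g0 addr0 => /(_ ler01); lra.
- have := gP 0 0 1 (hull0 _ (lexx _)) ler01.
  by rewrite g0 add0r mul1r => gPt; have := gPt ltac:(lra); lra.
- have v1 : hull E 1 (1 *: v) by apply: hull_mem; rewrite ?normr1.
  have := gP _ _ 0 v1 (lexx _).
  by rewrite scale1r => gPt; have := gPt ltac:(lra); lra.
Qed.

End Selection.

(** * The tree of nodes *)
Section Levels.
Variables (R : realType) (X : normedModType R) (e : X) (eps : nat -> R).
Hypotheses (e1 : `|e| = 1) (hD : Daugavet_property X).
Hypothesis eps0 : forall n, 0 < eps n.
Implicit Types (x y z u v : X) (E F : seq X).

Lemma dominated_sub F F' z :
  {subset F <= F'} -> dominated F z -> dominated F' z.
Proof. by move=> FF' Fz f; have [c /FF' cF fc] := Fz f; exists c. Qed.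

(** The children of all nodes of a level are collected; those of different
    parents need no relation to each other. *)
Lemma next_level (Q : set X) F (d : R) :
  totally_bounded Q -> 0 < d -> (forall z, z \in F -> `|z| < 1) ->
  exists F', [/\ forall z, z \in F -> dominated F' z,
    forall c, c \in F' -> `|c| < 1 & forall c, c \in F' -> orth d Q c].
Proof.
move=> tbQ d0; elim: F => [|z F IH] F1; first by exists [::].
have [|F' [F'd F'1 F'o]] := IH.
  by move=> w wF; apply: F1; rewrite inE wF orbT.
have [G Gz Gc] := children e1 hD tbQ (F1 z (mem_head _ _)) d0.
exists (G ++ F'); split=> [w|c|c].
- rewrite inE => /predU1P[->|wF].
    by apply: dominated_sub Gz => c cG; rewrite mem_cat cG.
  by apply: dominated_sub (F'd w wF) => c cG; rewrite mem_cat cG orbT.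
- by rewrite mem_cat => /orP[/Gc[]|/F'1].
- by rewrite mem_cat => /orP[/Gc[]|/F'o].
Qed.

(** [G n] is the [n]-th level of the tree and [E n] contains all earlier
    levels. Every node is a convex combination of nodes of the next level,
    although each node is almost l1-orthogonal to everything constructed
    before its level. The radius 32 covers all the coefficients that occur in
    the sequel. *)
Lemma levels : exists E G : nat -> seq X,
  [/\ forall n y, y \in G n -> `|y| < 1 /\ orth (eps n) (hull (e :: E n) 32) y,
      forall n m y, (m < n)%N -> y \in G m -> y \in E n,
      forall n v, v \in E n -> `|v| <= 1,
      forall n z, z \in G n -> dominated (G n.+1) z &
      forall n, G n != [::] ].
Proof.
have /choice[step stepP] (p : nat * (seq X * seq X)) : exists F',
    (forall z, z \in p.2.2 -> `|z| < 1) ->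
    [/\ forall z, z \in p.2.2 -> dominated F' z,
    forall c, c \in F' -> `|c| < 1 &
    forall c, c \in F' -> orth (eps p.1) (hull (e :: p.2.1) 32) c].
  have [F1|F1] := pselect (forall z, z \in p.2.2 -> `|z| < 1); last first.
    by exists [::] => /F1.
  have tb := @hull_totally_bounded _ _ (e :: p.2.1) 32.
  have [F' F'P] := next_level tb (eps0 p.1) F1.
  by exists F' => _; exact: F'P.
pose next n (S : seq X * seq X) :=
  let F := step (n, S) in (S.1 ++ F, F).
pose S := fix S n := if n is m.+1 then next m (S m) else ([::], [:: 0]).
pose E n := (S n).1; pose G n := step (n, S n).
have SS n : S n.+1 = (E n ++ G n, G n) by [].
have S1 n z : z \in (S n).2 -> `|z| < 1.
  elim: n z => [|n IH] z /=; first by rewrite inE => /eqP ->; rewrite normr0.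
  by have [_ + _] := stepP (n, S n) IH; exact.
have GP n := stepP (n, S n) (@S1 n).
have EE n v : v \in E n.+1 -> v \in E n \/ v \in G n.
  by rewrite {1}/E SS mem_cat => /orP.
exists E, G; split.
- by move=> n y yG; have [_ G1 Go] := GP n; split; [exact: G1|exact: Go].
- move=> n m y; elim: n => // n IH; rewrite ltnS leq_eqVlt => mn yG.
  rewrite /E SS mem_cat; case/predU1P: mn => [<-|mn]; first by rewrite yG orbT.
  by rewrite -/(E n) IH.
- elim=> // n IH v /EE[/IH//|vG].
  by have [_ G1 _] := GP n; exact/ltW/G1.
- by move=> n z zG; have [Gd _ _] := GP n.+1; exact: Gd.
- have nonempty n z : dominated (G n) z -> G n != [::].
    by move=> /(_ \0)[c cG _]; apply: contraTneq cG => ->.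
  elim=> [|n IH].
    by have [Gd _ _] := GP 0; apply/nonempty/(Gd 0); rewrite /= inE.
  have [Gd _ _] := GP n.+1; case E0 : (G n) IH => [//|y F] _.
  by apply/nonempty/(Gd y); rewrite -[(S n.+1).2]/(G n) E0 mem_head.
Qed.

End Levels.

(** * The set and its symmetrization *)
Section Construction.
Variables (R : realType) (X : normedModType R) (e : X).
Hypotheses (e1 : `|e| = 1).
Implicit Types (f g h : {linear X -> R^o}) (x y z u v w : X) (n m l k : nat).

(** The size of the perturbation of the nodes of level [n]. The tolerance
    [tol] has to be small even in comparison with [sz], whence the square. *)
Definition sz n : R := 16^-1 ^+ n.+1.
Definition tol n : R := sz n ^+ 2 / 64.

Lemma sz_gt0 n : 0 < sz n. Proof. by rewrite exprn_gt0. Qed.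

Lemma tol_gt0 n : 0 < tol n.
Proof. by rewrite divr_gt0// exprn_gt0// sz_gt0. Qed.

Lemma szS n : sz n.+1 = sz n / 16.
Proof. by rewrite /sz exprSr. Qed.

Lemma sz_le n m : (n <= m)%N -> sz m <= sz n.
Proof. by move=> nm; apply: ler_wiXn2l => //; lra. Qed.

Lemma sz_lt n m : (n < m)%N -> sz m <= sz n / 16.
Proof. by move=> /sz_le; rewrite szS. Qed.

Lemma sz_le16 n : sz n <= 16^-1.
Proof. by rewrite -[leRHS]expr1; exact: (@sz_le 0). Qed.

Lemma tol_le n : tol n <= sz n / 64.
Proof.
rewrite ler_pM2r// expr2 ler_piMr ?(ltW (sz_gt0 _))//.
by have := sz_le16 n; lra.
Qed.

Lemma sz_small n (d : R) : 0 < d -> exists2 m, (n <= m)%N & sz m <= d.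
Proof.
move=> d0; exists (maxn n (Num.truncn d^-1)); first exact: leq_maxl.
apply: le_trans (sz_le (leq_maxr _ _)) _.
have d1 : d^-1 < (Num.truncn d^-1).+1%:R by rewrite truncnS_gt.
rewrite /sz exprVn -[leRHS]invrK lef_pV2 ?posrE ?exprn_gt0 ?invr_gt0//.
apply: ltW; apply: lt_le_trans d1 _.
by rewrite -natrX ler_nat; apply: ltnW; exact: ltn_expl.
Qed.

Variables E G : nat -> seq X.
Hypothesis GP : forall n y, y \in G n ->
  `|y| < 1 /\ orth (tol n) (hull (e :: E n) 32) y.
Hypothesis GE : forall n m y, (m < n)%N -> y \in G m -> y \in E n.
Hypothesis E1 : forall n v, v \in E n -> `|v| <= 1.
Hypothesis Gd : forall n z, z \in G n -> dominated (G n.+1) z.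
Hypothesis G0 : forall n, G n != [::].

(** The factor 8 makes the functional of [select_functional] at most -2 up to
    a small error at [apex], which beats the loss caused by the factor [1 - sz
    n] in [point]. *)
Definition apex : X := 8 *: e.
Local Notation a := apex.

(** The nodes are pushed away from [apex], so that they stick out of the hull
    of the later nodes and [apex]; after symmetrization they lie between [-
    apex] and the later nodes. *)
Definition point n y := (1 - sz n) *: y - sz n *: a.

Definition points : set X :=
  [set a] `|` [set x | exists n y, y \in G n /\ x = point n y].

Definition exposed_points : set X := [set x | exposed points x].

Lemma linear_apex f : f a = 8 * f e.
Proof. exact: linearZ. Qed.

Lemma norm_a : `|a| = 8.
Proof. by rewrite normrZ e1 mulr1 ger0_norm. Qed.

Lemma norm_point n y : y \in G n -> `|point n y| <= 2.
Proof.
move=> /GP[y1 _]; apply: le_trans (ler_normB _ _) _.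
have s0 := sz_gt0 n; have s1 := sz_le16 n.
rewrite (normrZ (1 - sz n)) (normrZ (sz n)) norm_a (gtr0_norm s0).
rewrite ger0_norm; last by lra.
have : (1 - sz n) * `|y| <= (1 - sz n) * 1 by apply: ler_wpM2l; lra.
lra.
Qed.

Lemma norm_points x : points x -> `|x| <= 8.
Proof.
move=> [->|[n [y [yG ->]]]]; first by rewrite norm_a.
by have := norm_point yG; lra.
Qed.

Lemma point_neq n y : y \in G n -> point n y != a.
Proof.
move=> yG; apply/eqP => ya; have := norm_point yG.
by rewrite ya norm_a; lra.
Qed.

Lemma linear_point f n y :
  f (point n y) = (1 - sz n) * f y - sz n * f a.
Proof. by rewrite linearB [f (_ *: y)]linearZ [f (_ *: a)]linearZ. Qed.

Lemma exposed_a : exposed points a.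
Proof.
split; first by left.
have [f [fn fe]] := norming e.
exists f, 1, 1; split=> [y||x [->|[n [y [yG ->]]] _]] //.
- by rewrite mul1r.
- by rewrite eqxx.
have fa : f a = 8 by rewrite linear_apex fe e1 mulr1.
have := norm_point yG; have := fn (point n y).
have := ler_norm (f (point n y)); lra.
Qed.

(** The functional [g] adapted to [y] exceeds [1 + sz n] up to the tolerance
    at [point n y]. It is smaller by [sz n / 2] at all points of other levels:
    at earlier ones because it is about one half on their nodes, at later ones
    because they are perturbed much less. Within level [n] it exceeds its
    value at [point n y] by at most [tol n], so adding a multiple of [f] of
    order [sz n] yields a slice that is contained in level [n] and on which
    [f] is almost as large as at [point n y]. This slice is finite, hence
    contains an exposed point. *)
Lemma exposed_point f (C : R) n y : (forall x, `|f x| <= C * `|x|) -> 0 < C ->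
  y \in G n ->
  exists y', [/\ y' \in G n, exposed points (point n y') &
    f (point n y) - 2 * C * sz n <= f (point n y')].
Proof.
move=> fC C0 yG.
have [y1 oy] := GP yG.
have [g [gn gy ge gE]] := select_functional e1 (@E1 n) (ltW y1) oy.
have s0 := sz_gt0 n; have s1 := sz_le16 n.
have ep0 := tol_gt0 n; have ep1 := tol_le n.
pose de := sz n / (64 * C).
have C64 : 0 < 64 * C by rewrite mulr_gt0.
have de0 : 0 < de by rewrite divr_gt0.
have deC : de * (C * 8) = sz n / 8 by rewrite /de; field; lra.
have dee : de * (2 * C * sz n) = 2 * tol n by rewrite /de /tol; field; lra.
have ga := linear_apex g.
have gl x : g x <= `|x| by exact: le_trans (ler_norm _) (gn x).
have ga8 : - 8 <= g a.
  by have := gn a; rewrite norm_a ler_norml => /andP[].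
have gx0 : 1 + sz n - 2 * tol n <= g (point n y).
  rewrite linear_point.
  have : (1 - sz n) * (1 - tol n) <= (1 - sz n) * g y by apply: ler_wpM2l; lra.
  have : 0 <= sz n * tol n by rewrite mulr_ge0// ltW.
  have : sz n * (2 - 8 * tol n) <= sz n * - g a by apply: ler_wpM2l; lra.
  have : sz n * tol n <= 16^-1 * tol n by apply: ler_wpM2r; lra.
  lra.
have gsame y' : y' \in G n -> g (point n y') <= g (point n y) + tol n.
  move=> /GP[y'1 _]; rewrite !linear_point.
  have : (1 - sz n) * (1 - tol n) <= (1 - sz n) * g y by apply: ler_wpM2l; lra.
  have : (1 - sz n) * g y' <= (1 - sz n) * 1.
    by apply: ler_wpM2l; have := gl y'; lra.
  have : 0 <= sz n * tol n by rewrite mulr_ge0// ltW.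
  lra.
have gother x : points x -> (forall y', y' \in G n -> x != point n y') ->
    g x + sz n / 2 <= g (point n y).
  move=> [->|[m [y' [y'G ->]]]] xn; first lra.
  have sm0 := sz_gt0 m; have sm1 := sz_le16 m.
  have sga : sz m * - g a <= sz m * 8 by apply: ler_wpM2l; lra.
  rewrite [in leLHS]linear_point.
  have [nm|mn|nm] := ltngtP n m.
  - have := sz_lt nm.
    have : (1 - sz m) * g y' <= (1 - sz m) * 1.
      by apply: ler_wpM2l; have [? _] := GP y'G; have := gl y'; lra.
    lra.
  - have : (1 - sz m) * g y' <= (1 - sz m) * (2^-1 + tol n).
      by apply: ler_wpM2l; [lra|apply/gE/(GE mn)].
    have : 0 <= sz m * tol n by rewrite mulr_ge0// ltW.
    lra.
  - by move: y'G xn; rewrite -nm => y'G /(_ _ y'G); rewrite eqxx.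
have [h hE] := linear_comb 1 g de f.
have def x : points x -> - (sz n / 8) <= de * f x <= sz n / 8.
  move=> px; rewrite -ler_norml -deC normrM gtr0_norm// ler_pM2l//.
  by apply: le_trans (fC x) _; rewrite ler_pM2l// norm_points.
have pp y' : y' \in G n -> points (point n y').
  by move=> y'G; right; exists n, y'.
pose low := f (point n y) - 2 * C * sz n.
pose F := [seq point n y' | y' <- G n & low <= f (point n y')].
have [|||||x xF xE] := @finite_slice_exposed _ _ points F h (1 + de * C)
    (tol n) 8 (point n y) norm_points.
- move=> x; rewrite hE mul1r mulrDl mul1r -mulrA.
  apply: le_trans (ler_normD _ _) _.
  by rewrite lerD// normrM gtr0_norm// ler_pM2l.
- exact: tol_gt0.
- apply: map_f; rewrite mem_filter yG andbT /low gerBl.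
  by rewrite !mulr_ge0// ltW.
- by move=> _ /mapP[y' + ->]; rewrite mem_filter => /andP[_ /pp].
- move=> x px xF; rewrite !hE !mul1r.
  have [[y' y'G xy']|xn] := pselect (exists2 y', y' \in G n & x = point n y').
    have : f x < low.
      rewrite ltNge; apply/negP => lx; move/negP: xF; apply.
      by apply/mapP; exists y' => //; rewrite mem_filter y'G -xy' lx.
    rewrite -(ltr_pM2l de0) /low mulrBr dee.
    by have := gsame y' y'G; rewrite -xy'; lra.
  have : g x + sz n / 2 <= g (point n y).
    by apply: gother => // y' y'G; apply/eqP => xy'; apply: xn; exists y'.
  have := def x px; have := def _ (pp y yG); lra.
move/mapP: xF => [y' + xy']; rewrite mem_filter => /andP[ly' y'G].
by exists y'; split=> //; rewrite -xy'.
Qed.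

Lemma dominated_deep f n m y : (n <= m)%N -> y \in G n ->
  exists2 y', y' \in G m & f y <= f y'.
Proof.
elim: m => [|m IH]; first by rewrite leqn0 => /eqP -> yG; exists y.
rewrite leq_eqVlt => /predU1P[->|]; first by move=> yG; exists y.
rewrite ltnS => nm yG; have [y' y'G yy'] := IH nm yG.
have [y'' y''G yy''] := Gd y'G f; exists y'' => //; exact: le_trans yy''.
Qed.

Lemma exposed_level n : exists2 y, y \in G n & exposed points (point n y).
Proof.
case En : (G n) (G0 n) => [//|y F] _.
have yG : y \in G n by rewrite En mem_head.
have [|y' [y'G y'E _]] := @exposed_point \0 1 n y _ ltr01 yG.
  by move=> x; rewrite /= normr0 mulr_ge0.
by exists y'; rewrite -?En.
Qed.

Lemma SCD_exposed_points : SCD exposed_points.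
Proof.
split.
  exists 8; split=> [|M M8 x [px _]]; first exact: num_real.
  exact: le_trans (norm_points px) (ltW M8).
have [y0 y0G y0E] := exposed_level 0.
(* An enumeration, with [apex] as default value. *)
pose dec (j : option (nat * nat)) := if j is Some (l, i) then
  let v := point l (nth 0 (G l) i) in
  if `[< exposed_points v >] then v else a else a.
pose b n := if unpickle n is Some j then dec j else a.
have bA n : exposed_points (b n).
  rewrite /b; case: unpickle => [[[l i]|]|]; try exact: exposed_a.
  by rewrite /dec; case: asboolP => // _; exact: exposed_a.
exists (fun n => [set b n]); split.
  move=> n; have AP : exposed_points `<=` points by move=> x [].
  have bE := exposed_sub AP (bA n) (bA n).
  have [ba|ba] := eqVneq (b n) a.
    by apply: (exposed_is_slice bE y0E); rewrite ba point_neq.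
  by apply: (exposed_is_slice bE exposed_a); rewrite eq_sym.
split=> [n|D Db]; first by split; [exists (b n)|move=> _ ->].
have {}Db n : D (b n) by have [z [Dz <-]] := Db n.
move=> x Ax; apply: subset_closure; apply: sub_gen_smallest.
have [->|[l [y [yG xy]]]] := Ax.1.
  by have := Db (pickle (None : option (nat * nat))); rewrite /b pickleK.
have := Db (pickle (Some (l, index y (G l)))); rewrite /b pickleK /dec.
by rewrite nth_index// -xy; case: asboolP.
Qed.

(** The last term comes first, so that [hull] splits it off. *)
Fixpoint initial (s : nat -> X) n :=
  if n is m.+1 then s m :: initial s m else [::].

Lemma mem_initial (s : nat -> X) n v :
  v \in initial s n -> exists2 k, (k < n)%N & v = s k.
Proof.
elim: n => //= n IH; rewrite inE => /predU1P[->|/IH[k kn ->]].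
  by exists n.
by exists k => //; exact: ltnW.
Qed.

Lemma initial_sub (s : nat -> X) n m :
  (n <= m)%N -> {subset initial s n <= initial s m}.
Proof.
elim: m => [|m IH]; first by rewrite leqn0 => /eqP ->.
rewrite leq_eqVlt => /predU1P[-> //|/IH H v /H vm].
by rewrite inE vm orbT.
Qed.

(** A slice of the symmetrization that misses [apex] and [- apex] contains a
    signed point whose node alone is already large for the functional: the
    perturbation does not help. Its descendants are at least as large and,
    being perturbed less and less, produce points of the slice at arbitrarily
    deep levels, which [exposed_point] makes exposed. The coefficients [c] and
    [t] treat this case and [apex] itself uniformly. *)
Lemma slice_contains_deep (f : {linear X -> R^o}) (ep : R) N : continuous f ->
  0 < ep ->
  exists l y (c t : R), [/\ (N <= l)%N, y \in G l, `|c| <= 1, `|t| <= 1 &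
    slice (exposed_points `|` [set - x | x in exposed_points]) f ep
      (c *: a + t *: y)].
Proof.
move=> /continuous_linearW[C C0 fC] ep0.
set D := _ `|` _; rewrite /slice.
have D8 x : D x -> `|x| <= 8.
  by move=> [[px _]|[z [pz _] <-]]; rewrite ?normrN; exact: norm_points.
set T := sup _.
have Da : D a by left; exact: exposed_a.
have DN x : exposed_points x -> D (- x) by move=> Ax; right; exists x.
have [yN yNG _] := exposed_level N.
have [fa|fa] := ltP (T - ep) (f a).
  exists N, yN, 1, 0; rewrite normr1 normr0 scale1r scale0r addr0.
  by split=> //; split.
have [fNa|fNa] := ltP (T - ep) (f (- a)).
  exists N, yN, (-1), 0; rewrite normrN1 normr0 scaleN1r scale0r addr0.
  by split=> //; split=> //; exact/DN/exposed_a.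
rewrite linearN/= in fNa.
have HS : has_sup [set f x | x in D].
  split; first by exists (f a), a.
  exists (C * 8) => _ [x /D8 x8 <-]; apply: le_trans (ler_norm _) _.
  by apply: le_trans (fC x) _; rewrite ler_pM2l.
have [|_ [d Dd <-] fd] := @sup_adherent _ _ (ep / 2) _ HS.
  by rewrite divr_gt0.
rewrite -/T in fd.
have [sg [l [y [sg1 yG fy]]]] : exists (sg : R) l y,
    [/\ sg = 1 \/ sg = -1, y \in G l & T - ep / 2 < sg * f (point l y)].
  move: Dd fd =>
    [[[->|[l [y [yG ->]]]] _] fd|[_ [[->|[l [y [yG ->]]]] _] <-] fd].
  - lra.
  - by exists 1, l, y; rewrite mul1r; split=> //; left.
  - by rewrite linearN/= in fd; lra.
  - by exists (-1), l, y; rewrite mulN1r -linearN; split=> //; right.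
have [f' f'E] := linear_comb sg f 0 f.
have {}f'E x : f' x = sg * f x by rewrite f'E mul0r addr0.
have nsg : `|sg| = 1 by case: sg1 => ->; rewrite ?normrN1 ?normr1.
have f'C x : `|f' x| <= C * `|x| by rewrite f'E normrM nsg mul1r.
have f'a : - f' a <= T - ep by rewrite f'E; case: sg1 => ->; lra.
have f'a' : f' a <= T - ep by rewrite f'E; case: sg1 => ->; lra.
have f'y : T - ep / 2 < f' y.
  rewrite ltNge; apply/negP => yT.
  have s0 := sz_gt0 l; have s1 := sz_le16 l.
  have : (1 - sz l) * f' y <= (1 - sz l) * (T - ep / 2).
    by apply: ler_wpM2l; lra.
  have : sz l * - f' a <= sz l * (T - ep) by apply: ler_wpM2l; lra.
  have : 0 < sz l * ep by rewrite mulr_gt0.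
  by move: fy; rewrite -f'E linear_point; lra.
have [|m lNm sm] := @sz_small (maxn l N) (ep / (22 * C)).
  by rewrite divr_gt0// mulr_gt0.
have {}sm : 11 * C * sz m <= ep / 2.
  have -> : ep / 2 = 11 * C * (ep / (22 * C)) by field; lra.
  by rewrite ler_pM2l// mulr_gt0.
rewrite geq_max in lNm; have /andP[lm Nm] := lNm.
have [y' y'G yy'] := dominated_deep f' lm yG.
have [y'' [y''G y''E yy'']] := exposed_point f'C C0 y'G.
have s0 := sz_gt0 m; have s1 := sz_le16 m.
have fp : f' y' - 9 * C * sz m <= f' (point m y').
  rewrite linear_point.
  have [y'1 _] := GP y'G.
  have : sz m * (f' y' + f' a) <= sz m * (9 * C).
    apply: ler_wpM2l; first exact: ltW.
    have := ler_norm (f' y'); have := ler_norm (f' a).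
    have := f'C y'; have := f'C a; rewrite norm_a.
    have : C * `|y'| <= C * 1 by rewrite ler_pM2l// ltW.
    lra.
  lra.
exists m, y'', (- (sg * sz m)), (sg * (1 - sz m)).
rewrite normrN !normrM nsg !mul1r !ger0_norm; [|lra|lra].
have -> : - (sg * sz m) *: a + (sg * (1 - sz m)) *: y'' = sg *: point m y''.
  by rewrite scaleNr addrC -!scalerA -scalerBr.
split=> //; [lra|lra|split].
  by case: sg1 => ->; rewrite ?scaleN1r ?scale1r; [left|exact: DN].
have -> : f (sg *: point m y'') = f' (point m y'') by rewrite f'E [LHS]linearZ.
lra.
Qed.

(** Each node is almost l1-orthogonal to the nodes of lower levels, so adding
    nodes of increasing levels to [v] costs at most the sum of their
    tolerances. *)
Lemma far_from_deep (l : nat -> nat) (y : nat -> X) n A u v :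
  (forall k, y k \in G (l k)) -> (forall k, (k < l k)%N) ->
  {homo l : i j / (i < j)%N} ->
  A <= 1 -> hull (initial y n) A u ->
  (exists2 y0, y0 \in G 0 & hull [:: e; y0] 16 v) ->
  `|v| - (1 - 2^-1 ^+ n) / 4 <= `|v + u|.
Proof.
move=> yG lk lh A1 + [y0 y0G v16].
elim: n A u A1 => [|n IH] A u A1 /=.
  by move=> [-> _]; rewrite addr0; lra.
move=> [t [u' [-> tA u'A]]].
have t0 := normr_ge0 t.
have {}IH := IH _ _ _ u'A; have {IH} := IH ltac:(lra).
have [y1 oy] := GP (yG n).
have Q : hull (e :: E (l n)) 32 (v + u').
  apply: (@hull_le _ _ _ (16 + (A - `|t|))); first lra.
  apply: hullD.
    apply: hull_sub v16 => w; rewrite !inE => /orP[->//|/eqP ->].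
    by rewrite (GE _ y0G) ?orbT//; exact: leq_ltn_trans (lk n).
  apply: hull_sub u'A => w /mem_initial[k kn ->]; rewrite inE.
  by rewrite (GE _ (yG k)) ?orbT//; exact: lh.
have QN w : hull (e :: E (l n)) 32 w -> hull (e :: E (l n)) 32 (- w).
  exact: hullN.
have t1 : `|t| <= 1 by lra.
have := orth_scale QN (ltW y1) oy t1 Q.
have -> : v + (t *: y n + u') = v + u' + t *: y n.
  by rewrite -addrA [u' + _]addrC.
have : tol (l n) <= 2^-1 ^+ n / 8.
  apply: le_trans (tol_le _) _.
  have : sz (l n) <= 2^-1 ^+ n.
    apply: le_trans (sz_le (ltnW (lk n))) _.
    apply: (@le_trans _ _ (16^-1 ^+ n)).
      by apply: ler_wiXn2l; [lra|lra|exact: leqnSn].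
    by apply: lerXn2r; rewrite ?nnegrE; lra.
  have : (0 : R) <= 2^-1 ^+ n by rewrite exprn_ge0.
  lra.
rewrite exprS; lra.
Qed.

(** From given slices one picks elements of strictly increasing levels, or
    [apex] up to sign. Their convex combinations stay at distance at least one
    half from any exposed point of level 0. *)
Lemma not_SCD_symmetrized :
  ~ SCD (exposed_points `|` [set - x | x in exposed_points]).
Proof.
set D := _ `|` _.
move=> [_ [U [US [_ Udet]]]].
have rep (p : nat * nat) : exists q : (nat * X) * (R * R),
    [/\ (p.2 <= q.1.1)%N, q.1.2 \in G q.1.1, `|q.2.1| <= 1, `|q.2.2| <= 1 &
    U p.1 (q.2.1 *: a + q.2.2 *: q.1.2)].
  have [_ [f [ep [fc _ ep0 ->]]]] := US p.1.
  have [l [y [c [t [pl yG c1 t1 fs]]]]] := slice_contains_deep p.2 fc ep0.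
  by exists ((l, y), (c, t)).
have /choice[q qP] := rep.
pose N := fix N k := if k is k'.+1 then (q (k', N k')).1.1.+1 else 1%N.
pose l k := (q (k, N k)).1.1; pose y k := (q (k, N k)).1.2.
pose c k := (q (k, N k)).2.1; pose t k := (q (k, N k)).2.2.
have Nl k : (N k <= l k)%N by have [] := qP (k, N k).
have yG k : y k \in G (l k) by have [] := qP (k, N k).
have lS k : (l k < l k.+1)%N by exact: Nl k.+1.
have lh : {homo l : i j / (i < j)%N} by exact: homo_ltn ltn_trans lS.
have kl k : (k < l k)%N.
  elim: k => [|k IH]; first exact: Nl 0.
  exact: leq_ltn_trans IH (lS k).
have [y0 y0G y0E] := exposed_level 0.
pose B := [set c k *: a + t k *: y k | k in [set: nat]].
have DB : D `<=` closure (conv_hull B).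
  apply: Udet => k; exists (c k *: a + t k *: y k); split; first by exists k.
  by have [] := qP (k, N k).
pose W := [set w | exists n (d : R) u,
  [/\ w = d *: a + u, `|d| <= 1 & hull (initial y n) 1 u]].
have W_far w : W w -> 2^-1 <= `|point 0 y0 - w|.
  move=> [n [d [u [-> d1 uA]]]]; rewrite opprD addrA.
  have [y01 oy0] := GP y0G.
  have s1 := sz_le16 0; have s0 := sz_gt0 0; have tl := tol_le 0.
  have vE : point 0 y0 - d *: a = (- (8 * (sz 0 + d))) *: e + (1 - sz 0) *: y0.
    rewrite /point -addrA -opprD -scalerDl /apex scalerA addrC -scaleNr.
    by rewrite [_ * 8]mulrC.
  have dd : `|8 * (sz 0 + d)| <= 12.
    rewrite normrM ger0_norm//; have := ler_normD (sz 0) d.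
    by rewrite (gtr0_norm s0); lra.
  have v16 : hull [:: e; y0] 16 (point 0 y0 - d *: a).
    apply: (@hull_le _ _ _ (12 + 1)); first lra.
    rewrite vE; apply: hullD; apply: hull_mem; rewrite ?mem_head ?normrN//.
      by rewrite !inE eqxx orbT.
    by rewrite ger0_norm; lra.
  have v34 : 3 / 4 <= `|point 0 y0 - d *: a|.
    have e32 : hull (e :: E 0) 32 ((- (8 * (sz 0 + d))) *: e).
      by apply: hull_mem; rewrite ?mem_head// normrN; lra.
    have nt : `|1 - sz 0| = 1 - sz 0 by rewrite ger0_norm; lra.
    have := orth_scale (@hullN _ _ (e :: E 0) 32) (ltW y01) oy0
      (t := 1 - sz 0) _ e32.
    rewrite -vE nt => /(_ ltac:(lra)).
    have := normr_ge0 ((- (8 * (sz 0 + d))) *: e); lra.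
  have := far_from_deep yG kl lh (lexx _) (hullN uA)
    (ex_intro2 _ _ y0 y0G v16).
  have : (0 : R) <= 2^-1 ^+ n by rewrite exprn_ge0.
  lra.
have W_conv : conv_hull B `<=` W.
  apply: smallest_sub.
    move=> w1 w2 r; rewrite !inE => -[n1 [d1 [u1 [-> d11 u1A]]]].
    move=> [n2 [d2 [u2 [-> d21 u2A]]]].
    have r0 : 0 <= r%:num by [].
    have r1 : 0 <= 1 - r%:num by rewrite subr_ge0.
    exists (maxn n1 n2), (r%:num * d1 + (1 - r%:num) * d2),
      (r%:num *: u1 + (1 - r%:num) *: u2); split.
    - rewrite [LHS]/conv/= scalerDr [in X in _ + X = _]scalerDr addrACA.
      by rewrite (scalerDl a (r%:num * d1)) -(scalerA _ d1) -(scalerA _ d2).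
    - apply: le_trans (ler_normD _ _) _.
      rewrite (normrM r%:num) (normrM (1 - r%:num)).
      rewrite (ger0_norm r0) (ger0_norm r1).
      have : r%:num * `|d1| <= r%:num * 1 by exact: ler_wpM2l.
      have : (1 - r%:num) * `|d2| <= (1 - r%:num) * 1 by exact: ler_wpM2l.
      lra.
    - have u1' := hull_sub (@initial_sub y _ _ (leq_maxl n1 n2)) u1A.
      have u2' := hull_sub (@initial_sub y _ _ (leq_maxr n1 n2)) u2A.
      have := hullD (hullZ r%:num u1') (hullZ (1 - r%:num) u2').
      by rewrite !mulr1 !ger0_norm// subrKC.
  move=> _ [k _ <-]; exists k.+1, (c k), (t k *: y k).
  have [_ _ c1 t1 _] := qP (k, N k).
  by split=> //; apply: hull_mem => //; rewrite mem_head.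
have /DB : D (point 0 y0) by left.
move=> /(_ _ (nbhsx_ballx (point 0 y0) (2^-1 : R) ltac:(by rewrite invr_gt0))).
move=> [w [/W_conv/W_far w2]]; rewrite -ball_normE /= => w1.
by have := le_lt_trans w2 w1; rewrite ltxx.
Qed.

End Construction.

Theorem theorem2p9 (R : realType) (X : completeNormedModType R)
    (hX : exists x : X, x != 0) (hD : Daugavet_property X) :
  exists B : set X, SCD B /\ ~ SCD (B `|` [set - x | x in B]).
Proof.
have [x0 x00] := hX.
pose e := `|x0|^-1 *: x0.
have e1 : `|e| = 1 by rewrite normrZ normfV normr_id mulVf// normr_eq0.
have [E [G [GP GE E1 Gd G0]]] := levels e1 hD (@tol_gt0 R).
exists (exposed_points e G); split.
- exact: (SCD_exposed_points e1 GP GE E1 G0).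
- exact: (not_SCD_symmetrized e1 GP GE E1 Gd G0).
Qed.
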